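(* Let $b\in\{2,3,\dots\}$ and $\ell\in\{1,\dots,b-1\}$, and let $\phi:\mathbb{R}\to\mathbb{R}$ be the 1-periodic function with $$\phi(t)=\begin{cases}t\,\frac{b}{2\ell}&\text{if }0\le t\le \ell/b,\\ (1-t)\,\frac{b}{2(b-\ell)}&\text{if }\ell/b\le t\le 1.\end{cases}$$ Define $$\mu:=\frac{-b}{2(b-\ell)}\quad\text{and}\quad\nu:=\frac{b}{2\ell}.$$ Then the process $(Y_m)_{m\in\mathbb{N}}$ associated with $\phi$ and $b$ (defined in the context) is an i.i.d. sequence of $\{\mu,\nu\}$-valued random variables with $\mathbb{P}[Y_m=\nu]=\ell/b$ and $\mathbb{E}[Y_m]=0$.
   Context: $\mathbb{N}=\{1,2,\dots\}$. Given $\phi$ and $b$, define $$\lambda_{m,k}:=\frac{\phi((k+1)b^{-m})-\phi(kb^{-m})}{b^{-m}},\qquad m\in\mathbb{N},\ k=0,\dots,b^m-1.$$ Let $(\Omega,\mathscr{F},\mathbb{P})$ be a probability space supporting an independent sequence $U_1,U_2,\dots$ of random variables, each uniformly distributed on $\{0,1,\dots,b-1\}$, and define $$R_m:=\sum_{i=1}^mU_ib^{i-1},\qquad Y_m:=\lambda_{m,R_m},\qquad m\in\mathbb{N}.$$ *)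

(* Defs.v *)
From HB Require Import structures.
From mathcomp Require Import all_boot all_order all_algebra finmap.
From mathcomp Require Import all_classical all_reals all_analysis.

Set Implicit Arguments.
Unset Strict Implicit.
Unset Printing Implicit Defensive.

Import Order.TTheory GRing.Theory Num.Theory.
Local Open Scope classical_set_scope.
Local Open Scope ring_scope.

(* Sequences indexed by {1, 2, ...} are encoded as functions on [nat] whose
   value at 0 is irrelevant. *)
Definition posnat : set nat := [set n | (0 < n)%N].

Definition mutually_independent d d' (T : measurableType d)
    (T' : measurableType d') (R : realType) (P : probability T R)
    (I : choiceType) (D : set I) (X : I -> T -> T') : Prop :=
  forall (J : {fset I}) (B : I -> set T'),
    [set` J] `<=` D ->
    (forall i, i \in J -> measurable (B i)) ->
    P (\bigcap_(i in [set` J]) (X i @^-1` B i)) =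
      (\prod_(i <- J) P (X i @^-1` B i))%E.

Definition identically_distributed d d' (T : measurableType d)
    (T' : measurableType d') (R : realType) (P : probability T R)
    (I : choiceType) (D : set I) (X : I -> T -> T') : Prop :=
  forall i j, D i -> D j ->
    forall B : set T', measurable B -> P (X i @^-1` B) = P (X j @^-1` B).

Definition iid d d' (T : measurableType d) (T' : measurableType d')
    (R : realType) (P : probability T R)
    (I : choiceType) (D : set I) (X : I -> T -> T') : Prop :=
  [/\ forall i, D i -> measurable_fun [set: T] (X i),
      mutually_independent P D X &
      identically_distributed P D X].

(* The law of [X] is the uniform distribution on {0, ..., b - 1}; in particular
   [X < b] holds almost surely, since these b probabilities sum to 1. *)
Definition uniform_digit d (T : measurableType d) (R : realType)
    (P : probability T R) (b : nat) (X : T -> nat) : Prop :=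
  forall k, (k < b)%N -> P (X @^-1` [set k]) = (b%:R^-1)%:E.

Definition lambda (R : realType) (b : nat) (phi : R -> R) (m k : nat) : R :=
  (phi (k.+1%:R * b%:R ^- m) - phi (k%:R * b%:R ^- m)) / b%:R ^- m.

Definition Rindex (T : Type) (b : nat) (U : nat -> T -> nat) (m : nat) (w : T) :
    nat :=
  (\sum_(1 <= i < m.+1) U i w * b ^ (i - 1))%N.

Definition Yproc (R : realType) (T : Type) (b : nat) (phi : R -> R)
    (U : nat -> T -> nat) (m : nat) (w : T) : R :=
  lambda b phi m (Rindex b U m w).

(* Main.v *)
(** On a b-adic interval of level m >= 1 the function phi is affine, with slope
    nu or mu according to whether the leading base-b digit of the interval
    (after reduction mod 1) is less than l.  The leading digit of
    R_m = U_1 + U_2 b + ... + U_m b^(m-1) is U_m as soon as all the U_i are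
    less than b, so almost surely Y_m is a function of U_m alone. *)
Require Import Defs.
From HB Require Import structures.
From mathcomp Require Import all_boot all_order all_algebra ring lra.
From mathcomp Require Import all_classical all_reals all_analysis.

Set Implicit Arguments.
Unset Strict Implicit.
Unset Printing Implicit Defensive.

Import Order.TTheory GRing.Theory Num.Theory.
Local Open Scope classical_set_scope.
Local Open Scope ring_scope.

(** Each set is contained in the union of the other with a null set [N] covering the exceptions, so
    subadditivity gives both inequalities. This carries probabilities of events about [Y m] over to
    events about [U m]. *)
Lemma measure_ae_eq d (T : measurableType d) (R : realType)
    (mu : {measure set T -> \bar R}) (A B : set T) :
  measurable A -> measurable B -> {ae mu, forall x, A x <-> B x} ->
  mu A = mu B.
Proof.
move=> mA mB [N [mN N0 ABN]].
have le_mu (C D : set T) : measurable C -> measurable D ->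
    (forall x, ~ N x -> C x -> D x) -> (mu C <= mu D)%E.
  move=> mC mD CD; apply: (@le_trans _ _ (mu (D `|` N))).
    apply: le_measure; rewrite ?inE//; first exact: measurableU.
    by move=> x Cx; have [Nx|Nx] := pselect (N x); [right|left; exact: CD].
  apply: (le_trans (measureU2 mu mD mN)).
  by rewrite [X in (_ + X)%E]N0 adde0.
have iffAB x : ~ N x -> (A x <-> B x).
  by move=> Nx; apply: contrapT => nAB; apply: Nx; apply: ABN.
by apply/eqP; rewrite eq_le !le_mu// => x /iffAB[].
Qed.

(** The preimage splits into countably many pieces according to the value of [f]. *)
Lemma measurable_fun_nat2 d (T : measurableType d) (f g : T -> nat)
    (h : nat -> nat -> nat) :
  measurable_fun setT f -> measurable_fun setT g ->
  measurable_fun setT (fun x => h (f x) (g x)).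
Proof.
move=> mf mg _ B _; rewrite setTI.
have -> : (fun x => h (f x) (g x)) @^-1` B =
    \bigcup_n (f @^-1` [set n] `&` g @^-1` [set k | B (h n k)]).
  by apply/seteqP; split=> [x Bx|x [n _ [/= -> //]]]; exists (f x).
apply: bigcupT_measurable => n; apply: measurableI.
  by rewrite -[X in measurable X]setTI; exact: mf.
by rewrite -[X in measurable X]setTI; exact: mg.
Qed.

Lemma RindexS (T : Type) (b : nat) (U : nat -> T -> nat) m w :
  Rindex b U m.+1 w = (U m.+1 w * b ^ m + Rindex b U m w)%N.
Proof. by rewrite /Rindex big_nat_recr//= subn1 addnC. Qed.

Lemma measurable_Rindex d (T : measurableType d) (b : nat)
    (U : nat -> T -> nat) m :
  (forall i, measurable_fun setT (U i)) ->
  measurable_fun setT (Rindex b U m).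
Proof.
move=> mU; elim: m => [|m IHm].
  rewrite (_ : Rindex b U 0 = cst 0%N)//.
  by apply/funext => w; rewrite /Rindex big_geq.
rewrite (_ : Rindex b U m.+1 = fun w => (U m.+1 w * b ^ m + Rindex b U m w)%N).
  exact: (measurable_fun_nat2 (fun u r => u * b ^ m + r)%N (mU _) IHm).
by apply/funext => w; rewrite RindexS.
Qed.

Lemma Rindex_lt (T : Type) (b : nat) (U : nat -> T -> nat) m w :
  (forall i, (U i.+1 w < b)%N) -> (Rindex b U m w < b ^ m)%N.
Proof.
move=> Ub; elim: m => [|m IHm]; first by rewrite /Rindex big_geq.
rewrite RindexS expnS (@leq_trans ((U m.+1 w).+1 * b ^ m)%N)//.
  by rewrite mulSn addnC ltn_add2r.
by rewrite leq_mul2r Ub orbT.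
Qed.

Section digit_law.
Context d (T : measurableType d) (R : realType) (P : probability T R).
Variables (b : nat) (X : T -> nat).
Hypotheses (mX : measurable_fun setT X) (unifX : uniform_digit P b X).

(** Finite additivity over the single digits. The case [n = b] yields the almost sure bound on the
    digits, the case [n = l] the law of [Y m]. *)
Lemma uniform_digit_lt n : (n <= b)%N ->
  P (X @^-1` [set k | (k < n)%N]) = (n%:R / b%:R)%:E.
Proof.
elim: n => [_|n IHn ltnb].
  rewrite mulr0n mul0r (_ : _ @^-1` _ = set0) ?measure0//.
  by apply/seteqP; split.
have mXP (B : set nat) : measurable (X @^-1` B).
  by rewrite -[X in measurable X]setTI; exact: mX.
rewrite (_ : _ @^-1` _ = X @^-1` [set k | (k < n)%N] `|` X @^-1` [set n]).
  rewrite measureU//; last first.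
    by apply/seteqP; split=> // w [/= + Xw]; rewrite Xw ltnn.
  rewrite [X in (X + _)%E](IHn (ltnW ltnb)) [X in (_ + X)%E]unifX//.
  by rewrite -EFinD mulrSr mulrDl mul1r.
apply/seteqP; split=> w /=.
  by rewrite ltnS leq_eqVlt => /orP[/eqP|]; [right|left].
by case=> [/ltnW//|->].
Qed.

Lemma uniform_digit_ae : (0 < b)%N -> {ae P, forall w, (X w < b)%N}.
Proof.
move=> b0; exists (~` (X @^-1` [set k | (k < b)%N])).
have mA : measurable (X @^-1` [set k | (k < b)%N]).
  by rewrite -[X in measurable X]setTI; exact: mX.
split=> //; first exact: measurableC.
by rewrite probability_setC// uniform_digit_lt// divff ?pnatr_eq0 -?lt0n// subee.
Qed.

End digit_law.

Section tent.
Context (R : realType) (b l : nat).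
Hypotheses (l_gt0 : (0 < l)%N) (ltlb : (l < b)%N).
Variable phi : R -> R.
Hypotheses (phi_periodic : forall t, phi (t + 1) = phi t)
  (phi_left : forall t, 0 <= t <= l%:R / b%:R ->
     phi t = t * (b%:R / (2 * l%:R)))
  (phi_right : forall t, l%:R / b%:R <= t <= 1 ->
     phi t = (1 - t) * (b%:R / (2 * (b%:R - l%:R)))).
Local Notation mu := (- b%:R / (2 * (b%:R - l%:R)) : R).
Local Notation nu := (b%:R / (2 * l%:R) : R).

Lemma phi_natr t n : phi (t + n%:R) = phi t.
Proof.
elim: n => [|n IHn]; first by rewrite addr0.
by rewrite mulrSr addrA phi_periodic.
Qed.

(** No bound on [k] is assumed: periodicity reduces it modulo [b ^ m.+1]. The formula therefore
    applies at every sample point, including those where some digit is at least [b]. *)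
Lemma lambdaE m k :
  lambda b phi m.+1 k = if ((k %/ b ^ m) %% b < l)%N then nu else mu.
Proof.
have b_gt0 : (0 < b)%N by exact: leq_ltn_trans ltlb.
have bm_gt0 : (0 < b ^ m)%N by rewrite expn_gt0 b_gt0.
have bR : b%:R != 0 :> R by rewrite pnatr_eq0 -lt0n.
have BR : 0 < b%:R ^+ m.+1 :> R by rewrite exprn_gt0// ltr0n.
(* The digit tested is [k' %/ b ^ m] for the residue [k'] of [k] modulo [b ^ m.+1]; passing from [k]
   to [k'] moves the argument of [phi] by an integer. *)
rewrite modn_divl -expnS.
set k' := (k %% b ^ m.+1)%N.
have ltk' : (k' < b ^ m.+1)%N by rewrite ltn_mod expn_gt0 b_gt0.
have shift i : phi ((i + k)%:R * b%:R ^- m.+1) =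
               phi ((i + k')%:R * b%:R ^- m.+1).
  rewrite -[in RHS](phi_natr _ (k %/ b ^ m.+1)%N); congr phi.
  rewrite [in LHS](divn_eq k (b ^ m.+1)) -/k' !(natrD, natrM, natrX).
  by field; rewrite gt_eqF.
rewrite /lambda (shift 1%N) (shift 0%N) add0n add1n.
(* The kink of [phi] is a grid point of level [m.+1], so it is never interior to a grid interval. *)
have lbE : l%:R / b%:R = (l * b ^ m)%:R * b%:R ^- m.+1 :> R.
  rewrite natrM natrX exprS; field.
  by rewrite expf_neq0.
have k'E : k'.+1%:R = k'%:R + 1 :> R by rewrite -natr1.
have l0 : l%:R != 0 :> R by rewrite pnatr_eq0 -lt0n.
have bl0 : b%:R - l%:R != 0 :> R by rewrite subr_eq0 eqr_nat neq_ltn ltlb orbT.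
(* If [k' < l * b ^ m], then also [k'.+1 <= l * b ^ m] and both endpoints lie on the left branch;
   otherwise both lie on the right one, as [k'.+1 <= b ^ m.+1]. *)
rewrite ltn_divLR//; case: ltnP => [lek'|lek'].
  rewrite !phi_left.
  - by rewrite k'E; field; rewrite l0 gt_eqF.
  - by rewrite lbE divr_ge0 ?ler0n ?(ltW BR)// ler_pM2r ?invr_gt0// ler_nat ltnW.
  - by rewrite lbE divr_ge0 ?ler0n ?(ltW BR)// ler_pM2r ?invr_gt0// ler_nat.
rewrite !phi_right.
- by rewrite k'E; field; rewrite bl0 gt_eqF.
- rewrite lbE ler_pM2r ?invr_gt0// ler_nat lek'/=.
  by rewrite ler_pdivrMr// mul1r -natrX ler_nat ltnW.
- rewrite lbE ler_pM2r ?invr_gt0// ler_nat (leq_trans lek')//=.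
  by rewrite ler_pdivrMr// mul1r -natrX ler_nat.
Qed.

End tent.

Theorem proposition3p3 (R : realType) (d : measure_display)
  (Omega : measurableType d) (P : probability Omega R)
  (b l : nat) (hb : (2 <= b)%N) (hl : (1 <= l <= b - 1)%N)
  (phi : R -> R)
  (phi_periodic : forall t, phi (t + 1) = phi t)
  (phi_left : forall t, 0 <= t <= l%:R / b%:R ->
     phi t = t * (b%:R / (2 * l%:R)))
  (phi_right : forall t, l%:R / b%:R <= t <= 1 ->
     phi t = (1 - t) * (b%:R / (2 * (b%:R - l%:R))))
  (U : nat -> {RV P >-> nat})
  (U_indep : mutually_independent P posnat (fun i => U i : Omega -> nat))
  (U_unif : forall i, posnat i -> uniform_digit P b (U i))
  (mu nu : R)
  (mu_def : mu = - b%:R / (2 * (b%:R - l%:R)))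
  (nu_def : nu = b%:R / (2 * l%:R)) :
  let Y := Yproc b phi (fun i => U i : Omega -> nat) in
  iid P posnat Y /\
  (forall m, posnat m ->
    [/\ forall w, Y m w = mu \/ Y m w = nu,
        P [set w | Y m w = nu] = (l%:R / b%:R)%:E &
        ('E_P[Y m] = 0)%E]).
Proof.
move=> Y.
have [l_gt0 ltlb] : (0 < l)%N /\ (l < b)%N.
  by case/andP: hl => -> lel; split=> //; rewrite -(subnK (ltnW hb)) addn1 ltnS.
have b_gt0 : (0 < b)%N by exact: ltnW.
have b0 : 0 < b%:R :> R by rewrite ltr0n.
have l0 : 0 < l%:R :> R by rewrite ltr0n.
have bl0 : 0 < b%:R - l%:R :> R by rewrite subr_gt0 ltr_nat.
have nu_gt0 : 0 < nu by rewrite nu_def divr_gt0// mulr_gt0.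
have mu_lt0 : mu < 0 by rewrite mu_def mulNr oppr_lt0 divr_gt0// mulr_gt0.
pose g n : R := if (n < l)%N then nu else mu.
have YE m w : Y m.+1 w =
    g ((Rindex b (fun i => U i : Omega -> nat) m.+1 w %/ b ^ m) %% b)%N.
  by rewrite /Y /Yproc /g nu_def mu_def (lambdaE l_gt0).
have mU i : measurable_fun setT (U i) by exact: measurable_funPT.
have mUP i (B : set nat) : measurable (U i @^-1` B).
  by rewrite -[X in measurable X]setTI; exact: mU.
have mY m : measurable_fun setT (Y m).
  rewrite (_ : Y m = lambda b phi m \o Rindex b (fun i => U i : Omega -> nat) m)//.
  by apply: measurableT_comp => //; exact: measurable_Rindex.
have mYP m B : measurable B -> measurable (Y m @^-1` B).
  by move=> mB; rewrite -[X in measurable X]setTI; exact: mY.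
(* A countable union of null sets is null, so one exceptional set serves all indices at once, as
   joint events require. *)
have digits_ae : {ae P, forall w, forall i, (U i.+1 w < b)%N}.
  have := negligible_bigcup (fun i => uniform_digit_ae (mU i.+1) (U_unif i.+1 isT) b_gt0).
  by apply: negligibleS => w /existsNP[i Ui]; exists i.
have Yg_ae : {ae P, forall w, forall m, Y m.+1 w = g (U m.+1 w)}.
  (* Dividing [U m.+1 w * b ^ m + R_m] by [b ^ m] leaves [U m.+1 w] because [R_m < b ^ m], and
     reduction modulo [b] does not change a digit below [b]. *)
  apply: filterS digits_ae => w Ub m; rewrite YE RindexS divnMDl ?expn_gt0 ?b_gt0//.
  by rewrite (divn_small (Rindex_lt _ _)) ?addn0 ?modn_small.
have Yg_posnat w : (forall m, Y m.+1 w = g (U m.+1 w)) ->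
    forall m, posnat m -> Y m w = g (U m w) by move=> + [].
have PY m B : posnat m -> measurable B ->
    P (Y m @^-1` B) = P (U m @^-1` (g @^-1` B)).
  move=> m0 mB; apply: measure_ae_eq; [exact: mYP|exact: mUP|].
  by apply: filterS Yg_ae => w Yg; rewrite /preimage/= Yg_posnat.
(* The two slopes have opposite signs; being distinct, they let the value of [g] determine whether
   the digit is below [l]. *)
have nu_neq_mu : nu <> mu by move=> E; rewrite E in nu_gt0; lra.
have g_nu : g @^-1` [set nu] = [set k | (k < l)%N].
  by apply/seteqP; split=> k; rewrite /g/=; case: ifP => // _ /esym.
have PU_lt m (m0 : posnat m) :=
  uniform_digit_lt (mU m) (U_unif m m0) (ltnW ltlb).
have PU_ge m : posnat m ->
    P (U m @^-1` (~` [set k | (k < l)%N])) = (1 - (l%:R / b%:R)%:E)%E.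
  move=> m0; rewrite -(PU_lt m m0); apply: probability_setC.
  exact: (mUP m [set k | (k < l)%N]).
have PYnu m : posnat m -> P (Y m @^-1` [set nu]) = (l%:R / b%:R)%:E.
  by move=> m0; rewrite PY// g_nu PU_lt.
have Yval m w : posnat m -> Y m w = mu \/ Y m w = nu.
  by case: m => // m _; rewrite YE /g; case: ifP => _; [right|left].
split; first split=> [m _ //| |].
(* Both the joint event and the factors are replaced by events about the [U i] with the sets [B i]
   pulled back along [g]; independence of the digits then applies. *)
- move=> J B JD mB; rewrite (eq_big_seq (fun i => P (U i @^-1` (g @^-1` B i)))).
    rewrite -(U_indep J (fun i => g @^-1` B i))//.
    apply: measure_ae_eq.
    + by apply: bigcap_measurableType => i iJ; apply: mYP; exact: mB.
    + by apply: bigcap_measurableType => i iJ.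
    + apply: filterS Yg_ae => w /Yg_posnat Yg.
      by split=> YJ i iJ; move: (YJ i iJ); rewrite /preimage/= Yg//; exact: JD.
  by move=> i iJ; rewrite PY//; [exact: JD|exact: mB].
- move=> i j i0 j0 B mB; rewrite !PY//.
  have gB k : (g @^-1` B) k = (if (k < l)%N then B nu else B mu).
    by rewrite /preimage/= /g; case: ifP.
  (* Only four pullbacks of [B] along [g] can occur, and the probability that a digit falls in any
     of them does not depend on the index. *)
  have [Bnu|Bnu] := pselect (B nu); have [Bmu|Bmu] := pselect (B mu).
  + rewrite (_ : g @^-1` B = setT) ?preimage_setT//.
    by apply/seteqP; split=> // k _; rewrite gB; case: ifP.
  + rewrite (_ : g @^-1` B = [set k | (k < l)%N]) ?PU_lt//.
    by apply/seteqP; split=> k; rewrite gB /=; case: ifP.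
  + rewrite (_ : g @^-1` B = ~` [set k | (k < l)%N]) ?PU_ge//.
    by apply/seteqP; split=> k; rewrite gB /=; case: ifP.
  + rewrite (_ : g @^-1` B = set0) ?preimage_set0//.
    by apply/seteqP; split=> // k; rewrite gB; case: ifP.
- move=> m m0; split; [by move=> w; exact: Yval|exact: PYnu|].
  pose A := Y m @^-1` [set nu].
  have mA : measurable A by exact: mYP.
  have iA : \1_A \in Lfun P 1 by apply/Lfun1_integrable; exact: integrable_indic.
  (* As [Y m] takes only two values at every point, it is affine in the indicator of [A]. Its mean
     is [nu * l / b + mu * (b - l) / b], that is 1/2 - 1/2. *)
  rewrite (_ : Y m = cst mu \+ (nu - mu) \o* \1_A).
    rewrite expectationD ?Lfun_cst ?Lfun_scale//.
    rewrite expectation_cst expectationZl// expectation_indic//.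
    rewrite [X in (_ * X)%E]PYnu// -EFinM -EFinD; congr EFin.
    by rewrite mu_def nu_def; field; rewrite !gt_eqF.
  apply/funext => w; rewrite /= indicE.
  have [wA|wA] := boolP (w \in A); first by move/set_mem: wA => -> /=; lra.
  case: (Yval m w m0) => [->|Yw] /=; first by lra.
  by rewrite notin_setE in wA.
Qed.
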